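(* Let $G$ be a discrete group acting transitively on a countable set $X$, let $\mu$ be a finitely supported, generating and symmetric probability measure on $G$, and let $S$ be the support of $\mu$. Let $\beta:\mathbb{N}\to\mathbb{R}_{>0}$ be a non-increasing function satisfying $\lim_{n\to\infty}\beta(n)=0$. The action of $G$ on $X$ is amenable if and only if for any positive function $f:X\to\mathbb{R}$ that is superharmonic with respect to $\mu$ there exists a sequence $\{E_n\}$ of points of $X$ such that, for every $n$, every element $g\in G$ represented by a word in $S$ of length not exceeding $n$ satisfies $\left|\frac{f(gE_n)}{f(E_n)}-1\right|<\beta(n)$.
   Context: The action is a left action and $X$ is nonempty. The action of $G$ on $X$ is amenable if there is a $G$-invariant mean (finitely additive probability measure) on $X$. The measure $\mu$ is finitely supported if $\mu(A)=1$ for some finite $A\subset G$; generating if $G=\bigcup_{n\ge 0}\mathrm{supp}(\mu^{*n})$, where $\mu^{*n}$ is the $n$-fold convolution (so $S$ generates $G$); symmetric if $\mu(A)=\mu(A^{-1})$ for all $A\subset G$. The Markov operator is $Pf(x)=\sum_{g}\mu(g)f(gx)$. A function $f:X\to\mathbb{R}$ is superharmonic with respect to $\mu$ if $f(x)\ge Pf(x)$ for all $x\in X$. *)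

(* Defs.v *)
From HB Require Import structures.
From mathcomp Require Import all_boot all_order all_algebra.
From mathcomp Require Import all_classical all_reals all_analysis.
Import Order.TTheory GRing.Theory Num.Theory numFieldNormedType.Exports.

Set Implicit Arguments.
Unset Strict Implicit.
Unset Printing Implicit Defensive.

Local Open Scope classical_set_scope.
Local Open Scope ring_scope.

(* Aliases carrying the sigma-algebra of all subsets. Measurable types are
   pointed: a group is pointed by its neutral element. *)
Definition discrete_space (X : pointedType) : Type := X.

HB.instance Definition _ (X : pointedType) := Pointed.on (discrete_space X).
HB.instance Definition _ (X : pointedType) :=
  @isMeasurable.Build default_measure_display (discrete_space X)
    discrete_measurable (@discrete_measurable0 X)
    (@discrete_measurableC X) (@discrete_measurableU X).

Definition discrete_group (G : groupType) : Type := G.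

HB.instance Definition _ (G : groupType) := Choice.on (discrete_group G).
HB.instance Definition _ (G : groupType) :=
  isPointed.Build (discrete_group G) (1%g : G).
HB.instance Definition _ (G : groupType) :=
  @isMeasurable.Build default_measure_display (discrete_group G)
    discrete_measurable (@discrete_measurable0 G)
    (@discrete_measurableC G) (@discrete_measurableU G).

Section Action.
Context {G : groupType} {X : pointedType}.
Implicit Type act : G -> X -> X.

Definition left_action act :=
  (forall x, act 1%g x = x) /\
  (forall g h x, act (g * h)%g x = act g (act h x)).

Definition transitive_action act := forall x y, exists g, act g x = y.

(* A mean is a normalized content on the algebra of all subsets; since act is
   a left action, act g @` A is the translate gA. *)
Definition amenable_action (R : realType) act :=
  exists m : {content set (discrete_space X) -> \bar R},
    m [set: X] = 1%E /\ forall g (A : set X), m (act g @` A) = m A.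

End Action.

Section Walk.
Context {R : realType} {G : groupType}.
Implicit Type mu : probability (discrete_group G) R.

Definition finitely_supported mu :=
  exists A : set G, finite_set A /\ mu A = 1%E.

Definition symmetric_measure mu :=
  forall A : set G, mu A = mu [set (g^-1)%g | g in A].

Definition msupport (nu : set G -> \bar R) : set G :=
  [set g | nu [set g] != 0%E].

(* n-fold convolution, from (mu * nu)(A) = \int nu(h^-1 A) mu(dh). *)
Fixpoint convolution_power mu (n : nat) : set G -> \bar R :=
  if n is n'.+1 then
    fun A => (\int[mu]_h convolution_power mu n' [set g | A ((h : G) * g)%g])%E
  else \d_(1%g : discrete_group G).

Definition generating mu :=
  \bigcup_n msupport (convolution_power mu n) = [set: G].

(* Finite-support sum: only meaningful for finitely supported mu. *)
Definition markov_operator {X : Type} (act : G -> X -> X) mu (f : X -> R) (x : X) : R :=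
  \sum_(g \in [set: G]) fine (mu [set g]) * f (act g x).

Definition superharmonic {X : Type} (act : G -> X -> X) mu (f : X -> R) :=
  forall x, markov_operator act mu f x <= f x.

End Walk.

(* Elements represented by a word in S of length at most n. *)
Definition word_ball {G : groupType} (S : set G) (n : nat) : set G :=
  [set g | exists w : seq G,
     [/\ (size w <= n)%N, forall s, s \in w -> S s & g = (\prod_(s <- w) s)%g]].

(* Main.v *)
Require Import Defs.
From HB Require Import structures.
From mathcomp Require Import all_boot all_order all_algebra.
From mathcomp Require Import all_classical all_reals all_analysis.
From mathcomp Require Import ring lra zify.
Import Order.TTheory GRing.Theory Num.Theory numFieldNormedType.Exports.

Set Implicit Arguments.
Unset Strict Implicit.
Unset Printing Implicit Defensive.

Local Open Scope classical_set_scope.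
Local Open Scope ring_scope.

(* If the action is amenable and f > 0 is superharmonic, put u = ln f. From
   ln r <= (r - 1) - (sqrt r - 1)^2 and Pf <= f,
     sum_s mu(s) (u(sx) - u(x)) <= - sum_s mu(s) (sqrt (f(sx)/f(x)) - 1)^2.
   The increments of u are bounded, and by symmetry of mu the left-hand side has
   mean zero under any invariant mean. Hence f(sx)/f(x) cannot stay away from 1
   simultaneously along the finitely many steps of the words of length <= n.

   Conversely, let Q = (1 + P)/2. Either there are finitely supported phi on X
   with sum_s mu(s) |s phi - phi|^2 / |phi|^2 arbitrarily small, and an
   ultrafilter limit of the probability measures phi^2 / |phi|^2 is an invariant
   mean; or Q contracts l^2 strictly, |Q^n delta| decays geometrically, and
   f = sum_n t^n Q^n delta converges for some t > 1. Then Pf <= p f with p < 1,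
   which rules out points around which f is almost constant. *)

(** * Finitely supported probability measures on a group *)

Section FiniteSupport.
Context {R : realType} {G : groupType} (mu : probability (discrete_group G) R).
Implicit Types (g h : G) (A : set G).

Lemma discrete_groupP A : measurable (A : set (discrete_group G)).
Proof. by []. Qed.

Lemma measure_finite_set A : finite_set A ->
  mu A = (\sum_(g \in A) mu [set g])%E.
Proof.
move=> finA; rewrite -{1}[A]image_id -bigcup_imset1 measure_fin_bigcup//.
by apply/trivIsetP => i j _ _ /eqP ij; apply/seteqP; split=> // g [/= -> /ij].
Qed.

Lemma negligible_setC A : mu A = 1%E -> mu.-negligible (~` A).
Proof.
move=> muA; apply/negligibleP => //.
by apply: etrans (probability_setC mu (discrete_groupP A)) _; rewrite muA subee.
Qed.

Context (mu_fs : finitely_supported mu).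

(** This complement may be uncountable, so it is not enough that its points are null. A finite [A]
    of full measure settles it: the outside of [A] is negligible, and [A] minus the support is a
    finite union of null points. *)
Lemma measure_setC_msupport : mu (~` msupport mu) = 0%E.
Proof.
have [A [finA muA]] := mu_fs.
have nA := negligible_setC muA.
have nAS : mu.-negligible (A `\` msupport mu).
  apply/negligibleP => //; apply: etrans (measure_finite_set (finite_setD _ finA)) _.
  by apply: fsbig1 => g [_ /negP]; rewrite negbK => /eqP.
apply/negligibleP => //; apply: negligibleS (negligibleU nA nAS) => g Sg.
by have [Ag|Ag] := pselect (A g); [right|left].
Qed.

Lemma finite_msupport : finite_set (msupport mu).
Proof.
have [A [finA muA]] := mu_fs; apply: sub_finite_set finA => g /negP Sg.
apply: contrapT => Ag; apply: Sg; apply/eqP/negligibleP => //.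
by apply: negligibleS (negligible_setC muA) => h /= ->.
Qed.

Lemma msupport_seq : exists2 s : seq G, uniq s & msupport mu = [set` s].
Proof.
have /finite_seqP[s sE] := finite_msupport; exists (undup s); first exact: undup_uniq.
by rewrite sE; apply/seteqP; split=> g /=; rewrite mem_undup.
Qed.

Lemma weight_ge0 g : 0 <= fine (mu [set g]).
Proof. exact: fine_ge0. Qed.

Lemma weight_gt0 g : msupport mu g -> 0 < fine (mu [set g]).
Proof.
move=> Sg; apply: fine_gt0; rewrite lt0e measure_ge0 andbT.
by rewrite [_ != _]Sg/= ltey_eq fin_num_measure.
Qed.

Context (s : seq G) (s_uniq : uniq s) (sE : msupport mu = [set` s]).

Lemma sum_weight : \sum_(g <- s) fine (mu [set g]) = 1.
Proof.
have muT : mu (msupport mu `|` ~` msupport mu) = 1%E.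
  by rewrite setUv; exact: probability_setT.
have muU : mu (msupport mu `|` ~` msupport mu)
    = (mu (msupport mu) + mu (~` msupport mu))%E.
  by apply: measureU => //; exact: setICr.
apply: EFin_inj; rewrite -muT muU measure_setC_msupport adde0.
rewrite sE measure_finite_set; last exact: finite_seq.
rewrite -fsbig_seq// -sumEFin; apply: eq_bigr => g _.
by rewrite fineK// fin_num_measure.
Qed.

Lemma markov_operator_seq {X : Type} (act : G -> X -> X) (f : X -> R) x :
  markov_operator act mu f x = \sum_(g <- s) fine (mu [set g]) * f (act g x).
Proof.
rewrite fsbig_seq//; apply/esym/fsbig_widen => // g [_ /= gs].
have : ~ msupport mu g by rewrite sE.
by move/negP; rewrite negbK => /eqP -> /=; rewrite mul0r.
Qed.

(** If the integral defining the next power is nonzero, its integrand is nonzero at some [h] in [s],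
    the complement of [s] being null. This [h] is the first letter, and [h^-1 * g] lies in the
    support of the previous power. *)
Lemma convolution_power_msupport n g : msupport (convolution_power mu n) g ->
  exists2 w : seq G, all [in s] w & g = (\prod_(h <- w) h)%g.
Proof.
elim: n g => [|n IHn] g /=.
  rewrite /msupport/= diracE; case: (boolP (_ \in _)); last by rewrite eqxx.
  by rewrite inE /= => <- _; exists [::] => //; rewrite big_nil.
pose F h := convolution_power mu n [set k | [set g] (h * k)%g].
move=> Sg; have [h sh Fh] : exists2 h, h \in s & F h != 0%E.
  apply: contrapT => nF; move/negP: Sg; apply; apply/eqP.
  apply: etrans (integral0 mu setT); apply: ae_eq_integral => //.
  exists (~` msupport mu); split => //; first exact: measure_setC_msupport.
  move=> h /= Fh Sh; apply: Fh => _; rewrite -/(F h).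
  by apply: contrapT => /eqP Fh; apply: nF; exists h => //; move: Sh; rewrite sE.
have [|w sw gE] := IHn (h^-1 * g)%g.
  move: Fh; rewrite /F /msupport /= (_ : [set k | _] = [set (h^-1 * g)%g])//.
  by apply/seteqP; split => k /= => [<-|->]; rewrite ?mulKg ?mulVKg.
by exists (h :: w); rewrite /= ?sh// big_cons -gE mulVKg.
Qed.

Lemma generating_word : generating mu ->
  forall g, exists2 w : seq G, all [in s] w & g = (\prod_(h <- w) h)%g.
Proof.
move=> mu_gen g; have : [set: G] g by [].
by rewrite -mu_gen => -[n _ /convolution_power_msupport].
Qed.

Context (mu_sym : symmetric_measure mu).

Lemma weightV g : fine (mu [set g^-1%g]) = fine (mu [set g]).
Proof. by rewrite [in RHS]mu_sym image_set1. Qed.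

Lemma mem_supportV g : (g^-1%g \in s) = (g \in s).
Proof.
have memE h : (h \in s) = (mu [set h] != 0%E).
  by apply/idP/idP => [hs|hs]; [have : [set` s] h by []|have : msupport mu h by []];
    rewrite -?sE // sE.
by rewrite !memE [in RHS]mu_sym image_set1.
Qed.

Lemma reindex_supportV (F : G -> R) :
  \sum_(g <- s) F g = \sum_(g <- s) F g^-1%g.
Proof.
rewrite -[RHS](big_map (fun g => g^-1%g) xpredT F); apply: perm_big.
apply: uniq_perm => //; first by rewrite map_inj_uniq//; exact: invg_inj.
by move=> g; rewrite -[g in RHS]invgK mem_map ?mem_supportV//; exact: invg_inj.
Qed.

End FiniteSupport.

(** * Sums of finitely supported functions *)

Section FiniteSums.
Context {R : realType} {X : choiceType}.
Implicit Types F : X -> R.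

(** A sum over [[set: X]] takes the default value 0 when infinitely many terms are nonzero; this
    condition makes additivity and comparison of sums valid. *)
Definition fsupp F := finite_set [set x | F x != 0].

Lemma fsupp_sub F1 F2 : (forall x, F1 x = 0 -> F2 x = 0) -> fsupp F1 -> fsupp F2.
Proof.
by move=> F12; apply: sub_finite_set => x /=; apply: contra_neq => /F12.
Qed.

Lemma fsuppD F1 F2 : fsupp F1 -> fsupp F2 -> fsupp (fun x => F1 x + F2 x).
Proof.
move=> f1 f2; apply: (@sub_finite_set _ _ ([set x | F1 x != 0] `|` [set x | F2 x != 0])).
  move=> x /=; have [->|? _] := eqVneq (F1 x) 0; last by left.
  by rewrite add0r; right.
by rewrite finite_setU.
Qed.

Lemma fsupp_sum (I : Type) (s : seq I) (F : I -> X -> R) :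
  (forall i, fsupp (F i)) -> fsupp (fun x => \sum_(i <- s) F i x).
Proof.
move=> fF; elim: s => [|i s IHs].
  by apply: sub_finite_set (@finite_set0 X) => x /=; rewrite big_nil eqxx.
by under [X in fsupp X]eq_fun do rewrite big_cons; exact: fsuppD.
Qed.

Lemma fsupp_comp (h : X -> X) F : bijective h -> fsupp F -> fsupp (fun x => F (h x)).
Proof.
move=> [k hk kh] fF; apply: (@sub_finite_set _ _ (k @` [set x | F x != 0])).
  by move=> x /= Fx; exists (h x).
exact: finite_image.
Qed.

Lemma fsumE F (D : set X) : (forall x, ~ D x -> F x = 0) ->
  \sum_(x \in [set: X]) F x = \sum_(x \in D) F x.
Proof. by move=> DF; apply/esym/fsbig_widen => // x [_ /= /DF]. Qed.

Lemma fsumD F1 F2 : fsupp F1 -> fsupp F2 ->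
  \sum_(x \in [set: X]) (F1 x + F2 x) =
  \sum_(x \in [set: X]) F1 x + \sum_(x \in [set: X]) F2 x.
Proof.
move=> f1 f2; pose D := [set x | F1 x != 0] `|` [set x | F2 x != 0].
have D1 x : ~ D x -> F1 x = 0 by move=> /not_orP[/negP]; rewrite negbK => /eqP.
have D2 x : ~ D x -> F2 x = 0 by move=> /not_orP[_ /negP]; rewrite negbK => /eqP.
rewrite (fsumE D1) (fsumE D2) -fsbig_split/=; last by rewrite finite_setU.
by apply: fsumE => x Dx; rewrite D1// D2// addr0.
Qed.

Lemma fsumZ c F :
  \sum_(x \in [set: X]) c * F x = c * \sum_(x \in [set: X]) F x.
Proof. by rewrite mulr_fsumr. Qed.

Lemma fsum_big (I : Type) (s : seq I) (F : I -> X -> R) :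
  (forall i, fsupp (F i)) ->
  \sum_(x \in [set: X]) \sum_(i <- s) F i x =
  \sum_(i <- s) \sum_(x \in [set: X]) F i x.
Proof.
move=> fF; elim: s => [|i s IHs].
  by rewrite big_nil fsbig1// => x _; rewrite big_nil.
rewrite big_cons -IHs -fsumD//; last exact: fsupp_sum.
by apply: eq_fsbigr => x _; rewrite big_cons.
Qed.

Lemma ler_fsum F1 F2 : fsupp F1 -> fsupp F2 -> (forall x, F1 x <= F2 x) ->
  \sum_(x \in [set: X]) F1 x <= \sum_(x \in [set: X]) F2 x.
Proof.
move=> f1 f2 F12; rewrite -[leRHS](@eq_fsbigr _ _ _ _ (fun x => F1 x + (F2 x - F1 x))).
  rewrite fsumD//; last first.
    apply: fsuppD => //; apply: fsupp_sub f1 => x ->; exact: oppr0.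
  by rewrite lerDl; apply: fsumr_ge0 => x _; rewrite subr_ge0.
by move=> x _; rewrite addrC subrK.
Qed.

Lemma ler_fsum_term F x : fsupp F -> (forall y, 0 <= F y) ->
  F x <= \sum_(y \in [set: X]) F y.
Proof.
move=> fF F0; pose G y := if y == x then F x else 0.
have -> : F x = \sum_(y \in [set: X]) G y.
  rewrite (@fsumE _ [set x]) ?fsbig_set1 /G ?eqxx// => y /eqP.
  by move/negbTE => ->.
apply: ler_fsum => // [|y]; last by rewrite /G; case: eqP => [->|].
by apply: fsupp_sub fF => y; rewrite /G; case: eqP => [->|].
Qed.

End FiniteSums.

(** * The lazy walk on square-summable functions and its energy *)

Section LazyWalk.
Context {R : realType} {G : groupType} {X : pointedType} (act : G -> X -> X).
Context (act_left : left_action act).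

Lemma actK g : cancel (act g) (act g^-1%g).
Proof. by move=> x; rewrite -act_left.2 mulVg act_left.1. Qed.

Lemma actVK g : cancel (act g^-1%g) (act g).
Proof. by move=> x; rewrite -act_left.2 mulgV act_left.1. Qed.

Lemma act_bij g : bijective (act g).
Proof. by exists (act g^-1%g); [exact: actK|exact: actVK]. Qed.

Lemma fsum_act g (F : X -> R) :
  \sum_(x \in [set: X]) F (act g x) = \sum_(x \in [set: X]) F x.
Proof. by apply/esym; apply: reindex_fsbigT; exact: act_bij. Qed.

Context (s : seq G) (w : G -> R).
Context (w_ge0 : forall g, 0 <= w g) (w_sum : \sum_(g <- s) w g = 1).

(** The difference of the two sides is the variance of [a] under the weights [w]. *)
Lemma sqr_average_le (a : G -> R) :
  (\sum_(g <- s) w g * a g) ^+ 2 <= \sum_(g <- s) w g * a g ^+ 2.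
Proof.
set A := \sum_(g <- s) _.
rewrite -subr_ge0; have -> : \sum_(g <- s) w g * a g ^+ 2 - A ^+ 2 =
    \sum_(g <- s) w g * (a g - A) ^+ 2.
  transitivity (\sum_(g <- s) (w g * a g ^+ 2 - A * 2 * (w g * a g) + A ^+ 2 * w g)).
    rewrite big_split/= -mulr_sumr w_sum sumrB -mulr_sumr -/A.
    by ring.
  by apply: eq_bigr => g _; ring.
by apply: sumr_ge0 => g _; rewrite mulr_ge0// sqr_ge0.
Qed.

(** Averaging with the identity matters: the walk operator alone may preserve the norm of a function
    of large energy. *)
Definition lazy_step (phi : X -> R) x := (phi x + \sum_(g <- s) w g * phi (act g x)) / 2.

Definition sqnorm (phi : X -> R) := \sum_(x \in [set: X]) phi x ^+ 2.

(** For symmetric weights of sum 1 this is [2 <phi, (1 - P) phi>], twice the Dirichlet form of the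
    walk. *)
Definition energy (phi : X -> R) :=
  \sum_(g <- s) w g * sqnorm (fun x => phi (act g x) - phi x).

Lemma fsupp_sqr (phi : X -> R) : fsupp phi -> fsupp (fun x => phi x ^+ 2).
Proof. by apply: fsupp_sub => x ->; rewrite expr0n. Qed.

Lemma fsuppZ (c : R) (phi : X -> R) : fsupp phi -> fsupp (fun x => c * phi x).
Proof. by apply: fsupp_sub => x ->; rewrite mulr0. Qed.

Lemma fsupp_act g (phi : X -> R) : fsupp phi -> fsupp (fun x => phi (act g x)).
Proof. exact/fsupp_comp/act_bij. Qed.

Lemma fsupp_diff g (phi : X -> R) : fsupp phi -> fsupp (fun x => phi (act g x) - phi x).
Proof.
move=> fphi; apply: fsuppD; first exact: fsupp_act.
by apply: fsupp_sub fphi => x ->; rewrite oppr0.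
Qed.

Lemma fsupp_lazy (phi : X -> R) : fsupp phi -> fsupp (lazy_step phi).
Proof.
move=> fphi; apply: (@fsupp_sub _ _ (fun x => phi x + \sum_(g <- s) w g * phi (act g x))).
  by move=> x; rewrite /lazy_step => ->; rewrite mul0r.
apply: fsuppD => //; apply: fsupp_sum => g.
by apply: fsuppZ; exact: fsupp_act.
Qed.

Lemma lazy_ge0 (phi : X -> R) : (forall x, 0 <= phi x) -> forall x, 0 <= lazy_step phi x.
Proof.
move=> phi0 x; rewrite divr_ge0// addr_ge0//.
by apply: sumr_ge0 => g _; rewrite mulr_ge0.
Qed.

(* Parallelogram law: [((a + b) / 2)^2 = (a^2 + b^2) / 2 - (a - b)^2 / 4]. *)
Lemma sqnorm_lazy (phi : X -> R) : fsupp phi ->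
  sqnorm (lazy_step phi) <= sqnorm phi - energy phi / 4.
Proof.
move=> fphi.
pose F g x := w g * (2^-1 * phi x ^+ 2 + 2^-1 * phi (act g x) ^+ 2
                   + (- 4^-1) * (phi (act g x) - phi x) ^+ 2).
have fF1 g : fsupp (fun x => 2^-1 * phi x ^+ 2).
  by apply: fsuppZ; exact: fsupp_sqr.
have fF2 g : fsupp (fun x => 2^-1 * phi (act g x) ^+ 2).
  by apply: fsuppZ; apply: fsupp_sqr; exact: fsupp_act.
have fF3 g : fsupp (fun x => - 4^-1 * (phi (act g x) - phi x) ^+ 2).
  by apply: fsuppZ; apply: fsupp_sqr; exact: fsupp_diff.
have fF g : fsupp (F g).
  by apply: fsuppZ; do 2 apply: fsuppD => //; exact: fF1.
have -> : sqnorm phi - energy phi / 4 = \sum_(x \in [set: X]) \sum_(g <- s) F g x.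
  rewrite fsum_big// -[sqnorm phi]mul1r -{1}w_sum mulr_suml /energy mulr_suml -sumrB.
  apply: eq_bigr => g _; rewrite fsumZ fsumD//; last first.
    by apply: fsuppD => //; exact: fF1.
  rewrite fsumD//; last exact: fF1.
  transitivity (w g * (2^-1 * sqnorm phi + 2^-1 * sqnorm (fun x => phi (act g x))
      + (- 4^-1) * sqnorm (fun x => phi (act g x) - phi x))); last first.
    by congr (_ * (_ + _ + _)); apply/esym; exact: fsumZ.
  have -> : sqnorm (fun x => phi (act g x)) = sqnorm phi.
    exact: (fsum_act g (fun x => phi x ^+ 2)).
  by field.
apply: ler_fsum => [||x].
- exact/fsupp_sqr/fsupp_lazy.
- exact: fsupp_sum.
(* The lazy step is a weighted average of midpoints, so convexity of the square reduces the claim to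
   one identity for each [g]. *)
have -> : lazy_step phi x = \sum_(g <- s) w g * ((phi x + phi (act g x)) / 2).
  rewrite /lazy_step -[phi x in LHS]mul1r -w_sum mulr_suml -big_split/= mulr_suml.
  by apply: eq_bigr => g _; rewrite -mulrDr mulrA.
apply: le_trans (sqr_average_le _) _; apply: ler_sum => g _.
by rewrite ler_wpM2l// le_eqVlt; apply/orP; left; apply/eqP; field.
Qed.

(** The walk follows the word. The first letter acts last on [x], so it is consumed by the innermost
    [lazy_step], and the induction replaces [phi] by its lazy step. *)
Lemma lazy_iter_word (phi : X -> R) (v : seq G) x : all [in s] v ->
  (forall g, g \in s -> 0 < w g) -> (forall y, 0 <= phi y) ->
  0 < phi (act (\prod_(g <- v) g)%g x) -> 0 < iter (size v) lazy_step phi x.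
Proof.
move=> + w_gt0; elim: v phi => [|h v IHv] phi /=; first by rewrite big_nil act_left.1.
move=> /andP[hs vs] phi0; rewrite big_cons act_left.2 => phi_gt0.
rewrite -iterS iterSr; apply: IHv => //; first exact: lazy_ge0.
rewrite divr_gt0// ltr_wpDl// (big_rem h)//= ltr_wpDr//.
  by apply: sumr_ge0 => g _; rewrite mulr_ge0.
by rewrite mulr_gt0// w_gt0.
Qed.

End LazyWalk.

(** * From a spectral gap to a positive function with [P f <= p f] *)

Section SpectralGap.
Context {R : realType} {G : groupType} {X : pointedType} (act : G -> X -> X).
Context (act_left : left_action act) (s : seq G) (w : G -> R).
Context (w_ge0 : forall g, 0 <= w g) (w_gt0 : forall g, g \in s -> 0 < w g).
Context (w_sum : \sum_(g <- s) w g = 1).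
Context (word_trans : forall x y, exists2 v : seq G,
  all [in s] v & act (\prod_(g <- v) g)%g x = y).

Let Q := @lazy_step R G X act s w.

(** The series [f = sum_n t^n Q^n delta], with [delta] the unit mass at [point], satisfies
    [t Q f = f - delta <= f]. Since [Q = (1 + P) / 2], this reads [P f <= (2 / t - 1) f]. *)
Lemma gap_superharmonic (kappa : R) : 0 < kappa -> kappa <= 1 ->
  (forall phi : X -> R, fsupp phi -> (forall x, 0 <= phi x) ->
     kappa * sqnorm phi <= energy act s w phi) ->
  exists f : X -> R, exists2 p, (forall x, 0 < f x) /\ p < 1 &
    forall x, \sum_(g <- s) w g * f (act g x) <= p * f x.
Proof.
move=> k0 k1 gap; pose p := 1 - kappa / 8; pose t := 2 / (1 + p).
(* [t p < 1] makes the series converge, and [2 / t - 1 = p]. *)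
have p0 : 0 < p by rewrite /p; lra.
have p1 : p < 1 by rewrite /p; lra.
have t0 : 0 < t by rewrite divr_gt0// addr_gt0.
pose delta (x : X) : R := (x == point)%:R.
pose phi n := iter n Q delta.
have phi_ge0 n x : 0 <= phi n x.
  elim: n x => [|n IHn] x; first exact: ler0n.
  exact: lazy_ge0.
have phi_fsupp n : fsupp (phi n).
  elim: n => [|n IHn]; last exact: fsupp_lazy.
  apply: (@sub_finite_set _ _ [set point]); last exact: finite_set1.
  by move=> x; rewrite /phi/= /delta; have [->|_] := eqVneq x point; rewrite ?eqxx.
have phi_norm n : sqnorm (phi n) <= (p ^+ n) ^+ 2.
  elim: n => [|n IHn].
    rewrite /sqnorm (@fsumE _ _ _ [set point]); first by rewrite fsbig_set1 /phi/= /delta eqxx expr0 expr1n.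
    by move=> x /eqP/negbTE xp; rewrite /phi/= /delta xp expr0n.
  apply: le_trans (sqnorm_lazy act_left w_ge0 w_sum (phi_fsupp n)) _.
  (* The gap gives the factor [1 - kappa / 4], which is at most [(1 - kappa / 8)^2 = p^2]. *)
  apply: (@le_trans _ _ (p ^+ 2 * sqnorm (phi n))).
    have /= := gap _ (phi_fsupp n) (phi_ge0 n).
    have : 0 <= sqnorm (phi n) by apply: fsumr_ge0 => x _; exact: sqr_ge0.
    by rewrite /p; nra.
  by rewrite [p ^+ n.+1]exprS exprMn ler_wpM2l// sqr_ge0.
have phi_le n x : phi n x <= p ^+ n.
  rewrite -(ler_pXn2r (ltn0Sn 1))// ?nnegrE ?exprn_ge0 ?(ltW p0)//.
  apply: le_trans (phi_norm n).
  apply: (ler_fsum_term (F := fun x => phi n x ^+ 2)); last by move=> y; exact: sqr_ge0.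
  exact: fsupp_sqr.
pose u x n := t ^+ n * phi n x.
have u_ge0 x n : 0 <= u x n by rewrite mulr_ge0// exprn_ge0// ltW.
have u_cvg x : cvgn (series (u x)).
  apply: (@series_le_cvg _ _ (geometric 1 (t * p))) => // n.
  - by rewrite /= mul1r exprn_ge0// mulr_ge0// ltW.
  - by rewrite /= mul1r exprMn ler_wpM2l// exprn_ge0// ltW.
  apply: is_cvg_geometric_series; rewrite ger0_norm; last by rewrite mulr_ge0// ltW.
  by rewrite /t mulrAC ltr_pdivrMr; [lra|exact: addr_gt0].
pose f x := limn (series (u x)).
exists f, p; first split=> // x.
  (* A word leading from [x] to [point] makes the term indexed by its length positive; all the other
     terms are nonnegative. *)
  have [v vs vx] := word_trans x point.
  have u_gt0 : 0 < u x (size v).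
    apply: mulr_gt0; [exact: exprn_gt0|apply: lazy_iter_word => //].
    by rewrite vx /delta eqxx ltr01.
  apply: lt_le_trans u_gt0 _; apply: limr_ge => //.
  exists (size v).+1 => // n /= vn; rewrite /series/=.
  rewrite (big_cat_nat _ vn)//= big_nat_recr//=.
  by rewrite -addrA addrCA lerDl addr_ge0// sumr_ge0.
move=> x; have fx y : series (u y) n @[n --> \oo] --> f y by exact: u_cvg.
(* This is [t Q f <= f] for partial sums: [t Q] shifts the terms by one, so the sum of the first [n]
   becomes the sum of the first [n + 1] without the initial term. *)
have step n : \sum_(g <- s) w g * series (u (act g x)) n <=
    (1 + p) * series (u x) n.+1 - series (u x) n.
  suff : t * Q (fun y => series (u y) n) x <= series (u x) n.+1.
    have t2 : (1 + p) * t = 2 by rewrite /t; field; rewrite gt_eqF// addr_gt0.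
    rewrite /Q /lazy_step => /(ler_wpM2l (ltW (addr_gt0 ltr01 p0))).
    rewrite mulrA t2; lra.
  rewrite /series/= big_nat_recl// addrC.
  rewrite [leLHS](_ : _ = \sum_(0 <= i < n) u x i.+1); first by rewrite lerDl.
  transitivity (\sum_(0 <= i < n)
      ((u x i + \sum_(g <- s) w g * u (act g x) i) / 2 * t)).
    rewrite -!mulr_suml big_split/= exchange_big/= mulrC; congr ((_ + _) / 2 * t).
    by apply: eq_bigr => g _; rewrite mulr_sumr.
  apply: eq_bigr => i _; rewrite /u [phi i.+1]iterS -/(phi i) exprS /Q /lazy_step.
  rewrite (eq_bigr (fun g => t ^+ i * (w g * phi i (act g x)))); last first.
    by move=> g _; rewrite mulrCA.
  by rewrite -mulr_sumr; ring.
have L1 : \sum_(g <- s) w g * series (u (act g x)) n @[n --> \oo] -->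
    \sum_(g <- s) w g * f (act g x).
  apply: cvg_big => [|g _]; first exact: add_continuous.
  by apply: cvgMr; exact: fx.
have L2 : (1 + p) * series (u x) n.+1 - series (u x) n @[n --> \oo] -->
    (1 + p) * f x - f x.
  by apply: cvgB; [apply: cvgMr; rewrite (cvg_shiftS (series (u x)))|]; exact: fx.
have := ler_cvg_to L1 L2; rewrite [(1 + p) * f x - f x](_ : _ = p * f x); last by ring.
by apply; apply: nearW => n; exact: step.
Qed.

End SpectralGap.

(** * Ultrafilter limits and finitely additive contents *)

Section UltraLimit.

Lemma ultra_fmap {T U : Type} (f : T -> U) (F : set_system T) :
  UltraFilter F -> UltraFilter (f @ F).
Proof.
move=> FU; split=> [|H HP FH]; first exact: fmap_proper_filter.
apply/seteqP; split=> // A HA.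
have [//|FnA] := in_ultra_setVsetC (f @^-1` A) FU.
have HnA : H (~` A) by exact: FH.
by exfalso; apply: (@filter_not_empty _ H); rewrite -(setICr A); exact: filterI.
Qed.

Lemma ultra_bounded_cvg {R : realType} (F : set_system nat) (u : nat -> R) (a b : R) :
  UltraFilter F -> (forall n, a <= u n <= b) -> cvg (u n @[n --> F]).
Proof.
move=> FU uab; have Fab : (u @ F) `[a, b]%classic.
  by apply: (@filterE _ F) => n; have /andP[au ub] := uab n; rewrite /= in_itv/= au.
have := @segment_compact R a b; rewrite compact_ultra.
by move=> /(_ (u @ F) (ultra_fmap _ FU) Fab)[l [_ ul]]; apply/cvg_ex; exists l.
Qed.

End UltraLimit.

Lemma finitely_additive_content {R : realType} {X : pointedType} (L : set X -> R) :
  (forall A, 0 <= L A) ->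
  (forall A B, A `&` B = set0 -> L (A `|` B) = L A + L B) ->
  exists m : {content set (discrete_space X) -> \bar R}, forall A, m A = (L A)%:E.
Proof.
move=> L0 LD; pose m (A : set (discrete_space X)) := (L A)%:E.
have m_ge0 A : (0 <= m A)%E by rewrite lee_fin.
have m0 : m set0 = 0%E.
  have := LD set0 set0 (setI0 _); rewrite setU0 => /eqP.
  by rewrite -subr_eq subrr /m => /eqP <-.
have m_add : measure_function.semi_additive m.
  apply/(additive2P m0) => A B _ _ AB; rewrite /m -EFinD; congr EFin; exact: LD.
pose c : {content set (discrete_space X) -> \bar R} :=
  HB.pack m (isContent.Build _ _ _ m m_ge0 m_add).
by exists c.
Qed.

(** * From almost invariant functions to an invariant mean *)

Section AlmostInvariant.
Context {R : realType} {G : groupType} {X : pointedType} (act : G -> X -> X).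
Context (act_left : left_action act) (s : seq G).
Context (word : forall g, exists2 v : seq G, all [in s] v & g = (\prod_(h <- v) h)%g).

(** The mean is the limit along an ultrafilter refining [\oo], which exists for every set because
    the values lie in [[0, 1]]. The limit is exactly invariant under the letters in [s], hence under
    all words. *)
Lemma asymptotically_invariant_amenable (nu : nat -> set X -> R) :
  (forall n A, 0 <= nu n A) -> (forall n, nu n setT = 1) ->
  (forall n A B, A `&` B = set0 -> nu n (A `|` B) = nu n A + nu n B) ->
  (forall g, g \in s -> exists C, forall n A,
     `|nu n (act g @` A) - nu n A| <= C * harmonic n) ->
  amenable_action R act.
Proof.
move=> nu0 nuT nuD nu_inv.
have nu1 n A : nu n A <= 1.
  by rewrite -(nuT n) -(setUv A) nuD ?setICr// lerDl.
have [F [FU ooF]] := ultraFilterLemma (eventually_filter : ProperFilter \oo).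
have nu_cvg A : cvg (nu n A @[n --> F]).
  by apply: (@ultra_bounded_cvg _ _ _ 0 1) => n; rewrite nu0 nu1.
pose L A := lim (nu n A @[n --> F]).
have L_ge0 A : 0 <= L A by apply: limr_ge => //; exact: nearW.
have LD A B : A `&` B = set0 -> L (A `|` B) = L A + L B.
  move=> AB; transitivity (lim (nu n A + nu n B @[n --> F])); last exact: limD.
  by congr (lim (_ @ F)); apply/funext => n; exact: nuD.
have Ls g A : g \in s -> L (act g @` A) = L A.
  move=> gs; have [C nuC] := nu_inv _ gs; apply/eqP; rewrite -subr_eq0; apply/eqP.
  have -> : L (act g @` A) - L A = lim (nu n (act g @` A) - nu n A @[n --> F]).
    by rewrite limB.
  have Coo : C * harmonic n @[n --> \oo] --> (0 : R).
    by rewrite -[X in _ --> X](mulr0 C); apply: cvgMr; exact: cvg_harmonic.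
  apply/cvg_lim => //; apply: norm_cvg0.
  apply: (@squeeze_cvgr _ _ _ _ (cst 0) (fun n => C * harmonic n)).
  - by apply: nearW => n; rewrite normr_ge0 nuC.
  - exact: cvg_cst.
  - by move=> A' /Coo; exact: ooF.
have Lg g A : L (act g @` A) = L A.
  have [v vs ->] := word g; elim: v vs => [_|h v IHv /= /andP[hs vs]].
    rewrite big_nil; congr L; apply/seteqP; split=> [_ [x Ax <-]|x Ax]/=.
      by rewrite act_left.1.
    by exists x => //; exact: act_left.1.
  rewrite big_cons; apply: etrans (IHv vs); apply: etrans (Ls _ _ hs).
  rewrite image_comp.
  by congr L; apply: eq_imagel => x _; rewrite act_left.2.
have [m mE] := finitely_additive_content L_ge0 LD.
exists m; split=> [|g A]; rewrite !mE ?Lg//.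
congr EFin; rewrite /L (_ : (fun _ => _) = cst 1) ?lim_cst//.
by apply/funext => n; exact: nuT.
Qed.

Context (w : G -> R) (w_ge0 : forall g, 0 <= w g).
Context (w_gt0 : forall g, g \in s -> 0 < w g).

(* [(N / 2) (a - b)^2 - c (a^2 - b^2) + c^2 (a + b)^2 / (2 N)] is a square. *)
Lemma diff_sqr_le (N a b c : R) : 0 < N -> `|c| <= 1 ->
  c * (a ^+ 2 - b ^+ 2) <= N / 2 * (a - b) ^+ 2 + N^-1 * (a ^+ 2 + b ^+ 2).
Proof.
move=> N0 c1.
have c2 : c ^+ 2 <= 1 by rewrite -real_normK ?num_real// expr_le1.
have N2 : 0 <= N / 2 * ((a - b) - c * (a + b) / N) ^+ 2.
  by rewrite mulr_ge0 ?sqr_ge0// divr_ge0// ltW.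
have : c ^+ 2 * (a + b) ^+ 2 <= 2 * (a ^+ 2 + b ^+ 2).
  have := sqr_ge0 (a - b); have := sqr_ge0 (a + b); nra.
have N1 : 0 <= N^-1 / 2 by rewrite divr_ge0// invr_ge0 ltW.
rewrite -subr_ge0 => /(mulr_ge0 N1) h.
rewrite -subr_ge0; apply: le_trans (addr_ge0 N2 h) _.
by rewrite le_eqVlt; apply/orP; left; apply/eqP; field; rewrite gt_eqF.
Qed.

(** Summing the pointwise inequality replaces Cauchy-Schwarz and avoids roots of norms. The factor 2
    appears because translation by [g] preserves the norm; the free parameter [N] balances the two
    terms later. *)
Lemma fsum_diff_sqr_le (N : R) (c phi : X -> R) g : 0 < N -> fsupp phi ->
  (forall x, `|c x| <= 1) ->
  \sum_(x \in [set: X]) c x * (phi (act g x) ^+ 2 - phi x ^+ 2) <=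
  N / 2 * sqnorm (fun x => phi (act g x) - phi x) + N^-1 * (sqnorm phi *+ 2).
Proof.
move=> N0 fphi c1.
have f1 := fsuppZ (N / 2) (fsupp_sqr (fsupp_diff act_left g fphi)).
have f2 := fsuppD (fsupp_sqr (fsupp_act act_left g fphi)) (fsupp_sqr fphi).
have f3 := fsuppZ N^-1 f2.
have -> : N / 2 * sqnorm (fun x => phi (act g x) - phi x) + N^-1 * (sqnorm phi *+ 2) =
    \sum_(x \in [set: X]) (N / 2 * (phi (act g x) - phi x) ^+ 2 +
      N^-1 * (phi (act g x) ^+ 2 + phi x ^+ 2)).
  rewrite (fsumD f1 f3); congr (_ + _); first by apply/esym; exact: fsumZ.
  apply: etrans (esym (fsumZ _ _)); congr (_ * _).
  rewrite fsumD; [|exact: fsupp_sqr (fsupp_act act_left g fphi)|exact: fsupp_sqr].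
  by rewrite mulr2n; congr (_ + _); apply/esym/(fsum_act act_left g (fun x => phi x ^+ 2)).
apply: ler_fsum => [||x]; [|exact: fsuppD|exact: diff_sqr_le].
apply: fsupp_sub f2 => x /eqP; rewrite paddr_eq0 ?sqr_ge0// => /andP[/eqP -> /eqP ->].
by rewrite subrr mulr0.
Qed.

Lemma almost_invariant_amenable :
  (forall kappa : R, 0 < kappa -> exists2 phi : X -> R,
     fsupp phi & energy act s w phi < kappa * sqnorm phi) ->
  amenable_action R act.
Proof.
move=> ai; have h_gt0 n : 0 < harmonic n :> R by rewrite /harmonic/= invr_gt0.
have /choice[phi phiP] n : exists phi : X -> R,
    fsupp phi /\ energy act s w phi < harmonic n ^+ 2 * sqnorm phi.
  by have [|phi] := ai (harmonic n ^+ 2); [exact: exprn_gt0|exists phi].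
have phi_f n := (phiP n).1; have phi_E n := (phiP n).2.
have sq0 (f : X -> R) : 0 <= sqnorm f by apply: fsumr_ge0 => x _; exact: sqr_ge0.
have E0 (f : X -> R) : 0 <= energy act s w f.
  by apply: sumr_ge0 => g _; rewrite mulr_ge0.
(* The strict energy bound excludes a zero norm, so normalizing is legitimate. *)
have phi_gt0 n : 0 < sqnorm (phi n).
  rewrite lt_neqAle sq0 andbT eq_sym; apply/eqP => phi0.
  by have := phi_E n; rewrite phi0 mulr0 ltNge E0.
pose mass n (c : X -> R) := \sum_(x \in [set: X]) c x * phi n x ^+ 2.
have mass_f n c : fsupp (fun x => c x * phi n x ^+ 2).
  by apply: fsupp_sub (phi_f n) => x ->; rewrite expr0n mulr0.
pose nu n A := mass n (\1_A : X -> R) / sqnorm (phi n).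
apply: (@asymptotically_invariant_amenable nu).
- move=> n A; apply: divr_ge0; last exact: sq0.
  by apply: fsumr_ge0 => x _; rewrite mulr_ge0 ?sqr_ge0.
- move=> n; rewrite /nu /mass indicT.
  rewrite (eq_fsbigr (fun x => phi n x ^+ 2)) => [|x _]; last exact: mul1r.
  by rewrite -/(sqnorm _) divff// gt_eqF.
- move=> n A B AB; rewrite /nu -mulrDl /mass -fsumD//; congr (_ / _).
  apply: eq_fsbigr => x _; rewrite -mulrDl; congr (_ * _).
  rewrite !indicE in_setU; have : (x \in A `&` B) = false by rewrite AB in_set0.
  by rewrite in_setI; case: (x \in A); case: (x \in B) => //=; rewrite ?addr0 ?add0r.
(* Take [N = 1 / harmonic n]. The energy bound gives [D <= harmonic n ^ 2 * |phi n|^2 / w g], so the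
   two terms contribute [harmonic n / (2 w g)] and [2 harmonic n] after normalization. *)
move=> g gs; exists ((w g)^-1 / 2 + 2) => n A.
pose c := (\1_A : X -> R).
have c1 x : `|c x| <= 1 by rewrite /c indicE; case: (_ \in _); rewrite ?normr1 ?normr0.
have h0 := h_gt0 n.
pose D := sqnorm (fun x => phi n (act g x) - phi n x).
have DE : w g * D <= harmonic n ^+ 2 * sqnorm (phi n).
  apply: le_trans (ltW (phi_E n)); rewrite /energy (big_rem g)//= lerDl.
  by apply: sumr_ge0 => h _; rewrite mulr_ge0.
(* A general [d] serves for both [c] and [- c], which together bound the absolute value. *)
have bound (d : X -> R) : (forall x, `|d x| <= 1) ->
    \sum_(x \in [set: X]) d x * (phi n (act g x) ^+ 2 - phi n x ^+ 2) <=
    ((w g)^-1 / 2 + 2) * harmonic n * sqnorm (phi n).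
  move=> d1; have hV : 0 < (harmonic n)^-1 :> R by rewrite invr_gt0.
  apply: le_trans (fsum_diff_sqr_le g hV (phi_f n) d1) _.
  have wg := w_gt0 gs.
  have -> : ((w g)^-1 / 2 + 2) * harmonic n * sqnorm (phi n) =
      (harmonic n)^-1 / 2 * (w g)^-1 * (harmonic n ^+ 2 * sqnorm (phi n)) +
      harmonic n * (sqnorm (phi n) *+ 2).
    by field; rewrite !gt_eqF.
  rewrite invrK lerD2r -[leRHS]mulrA; apply: ler_wpM2l.
    by rewrite divr_ge0// invr_ge0 ltW.
  by rewrite mulrC ler_pdivlMr// mulrC.
(* Substituting [g x] for [x] turns the indicator of [g A] into that of [A] and moves the
   translation onto [phi n]. *)
have -> : nu n (act g @` A) - nu n A =
    (\sum_(x \in [set: X]) c x * (phi n (act g x) ^+ 2 - phi n x ^+ 2)) / sqnorm (phi n).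
  rewrite /nu -mulrBl; congr (_ / _); rewrite /mass.
  rewrite -(fsum_act act_left g) -[in LHS]mulN1r -fsumZ -fsumD.
  - apply: eq_fsbigr => x _; rewrite mulN1r mulrBr; congr (_ * _ - _).
    rewrite /c !indicE; congr ((nat_of_bool _)%:R); apply/idP/idP; rewrite !inE.
      by move=> [y Ay /(can_inj (actK act_left g)) <-].
    by move=> Ax; exists x.
  - apply: fsupp_sub (fsupp_act act_left g (phi_f n)) => x ->.
    by rewrite expr0n mulr0.
  - by apply: fsuppZ; exact: mass_f.
rewrite ler_norml; apply/andP; split; last first.
  by rewrite ler_pdivrMr//; exact: bound.
rewrite ler_pdivlMr// mulNr lerNl -mulN1r -fsumZ.
rewrite (eq_fsbigr (fun x => - c x * (phi n (act g x) ^+ 2 - phi n x ^+ 2))).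
  by apply: bound => x; rewrite normrN.
by move=> x _; rewrite mulN1r mulNr.
Qed.

End AlmostInvariant.

(** * Integrating finitely valued functions against an invariant mean *)

Section FiniteMean.
Context {R : realType} {G : groupType} {X : pointedType} (act : G -> X -> X).
Context (M : set X -> R) (M_ge0 : forall A, 0 <= M A) (MT : M setT = 1).
Context (MU : forall A B, A `&` B = set0 -> M (A `|` B) = M A + M B).
Context (M_act : forall g A, M (act g @^-1` A) = M A).

Lemma mean_set0 : M set0 = 0.
Proof.
by have /eqP := MU (setI0 set0); rewrite setU0 -subr_eq subrr => /eqP <-.
Qed.

Lemma mean_preimage (T : finType) (psi : X -> T) (P : pred T) :
  M [set x | P (psi x)] = \sum_(t | P t) M [set x | psi x = t].
Proof.
rewrite -[RHS]big_filter.
have -> : [set x | P (psi x)] = [set x | psi x \in [seq t <- index_enum T | P t]].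
  by apply/seteqP; split=> x /=; rewrite mem_filter mem_index_enum andbT.
elim: [seq t <- _ | _] (filter_uniq P (index_enum_uniq T)) => [_|t r IHr /= /andP[tr ur]].
  by rewrite big_nil -mean_set0; congr M; apply/seteqP; split.
rewrite big_cons -IHr// -MU.
  congr M; apply/seteqP; split=> x /=; rewrite in_cons.
    by move=> /orP[/eqP|]; [left|right].
  by move=> [->|->]; rewrite ?eqxx ?orbT.
by apply/seteqP; split=> // x [/= -> tr']; rewrite tr' in tr.
Qed.

(** The integral is a relation: [h] is factored through a finite type, and the value is read off the
    masses of the fibres. Different factorizations agree by [has_mean_unique]. *)
Definition has_mean (h : X -> R) (r : R) := exists (T : finType) (psi : X -> T)
  (a : T -> R), (forall x, h x = a (psi x)) /\ r = \sum_t a t * M [set x | psi x = t].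

(** Each fibre of the coarser partition is a disjoint union of fibres of [psi]. This puts two
    functions over one common partition, indexed by a product type. *)
Lemma mean_comp (T U : finType) (psi : X -> T) (p : T -> U) (a : U -> R) :
  \sum_u a u * M [set x | p (psi x) = u] =
  \sum_t a (p t) * M [set x | psi x = t].
Proof.
rewrite [RHS](partition_big p xpredT)//=; apply: eq_bigr => u _.
rewrite (_ : [set x | p (psi x) = u] = [set x | p (psi x) == u]); last first.
  by apply/seteqP; split=> x /= /eqP.
rewrite (mean_preimage psi (fun t => p t == u)) mulr_sumr.
by apply: eq_bigr => t /eqP ->.
Qed.

Lemma has_meanD h1 h2 r1 r2 : has_mean h1 r1 -> has_mean h2 r2 ->
  has_mean (fun x => h1 x + h2 x) (r1 + r2).
Proof.
move=> [T1 [p1 [a1 [h1E ->]]]] [T2 [p2 [a2 [h2E ->]]]].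
exists (T1 * T2)%type, (fun x => (p1 x, p2 x)), (fun t => a1 t.1 + a2 t.2).
split=> [x|]; first by rewrite h1E h2E.
under [RHS]eq_bigr do rewrite mulrDl.
by rewrite big_split/= -!(mean_comp (fun x => (p1 x, p2 x))).
Qed.

Lemma has_meanZ c h r : has_mean h r -> has_mean (fun x => c * h x) (c * r).
Proof.
move=> [T [p [a [hE ->]]]]; exists T, p, (fun t => c * a t); split=> [x|].
  by rewrite hE.
by rewrite mulr_sumr; apply: eq_bigr => t _; rewrite mulrA.
Qed.

Lemma has_mean0 : has_mean (fun=> 0) 0.
Proof.
exists unit, (fun=> tt), (fun=> 0); split=> //.
by rewrite big1// => t _; rewrite mul0r.
Qed.

Lemma has_mean_sum (I : eqType) (l : seq I) (h : I -> X -> R) (r : I -> R) :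
  (forall i, i \in l -> has_mean (h i) (r i)) ->
  has_mean (fun x => \sum_(i <- l) h i x) (\sum_(i <- l) r i).
Proof.
elim: l => [_|i l IHl hl].
  rewrite big_nil (_ : (fun _ => _) = fun=> 0); first exact: has_mean0.
  by apply/funext => x; rewrite big_nil.
rewrite big_cons (_ : (fun _ => _) = fun x => h i x + \sum_(i <- l) h i x).
  apply: has_meanD; first by apply: hl; rewrite mem_head.
  by apply: IHl => j jl; apply: hl; rewrite in_cons jl orbT.
by apply/funext => x; rewrite big_cons.
Qed.

Lemma has_mean_act g h r : has_mean h r -> has_mean (fun x => h (act g x)) r.
Proof.
move=> [T [p [a [hE ->]]]]; exists T, (fun x => p (act g x)), a; split=> [x|]; first exact: hE.
by apply: eq_bigr => t _; rewrite -(M_act g [set x | p x = t]).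
Qed.

Lemma has_mean_le c h r : has_mean h r -> (forall x, h x <= c) -> r <= c.
Proof.
move=> [T [p [a [hE ->]]]] hc.
have -> : c = \sum_t c * M [set x | p x = t].
  rewrite -mulr_sumr -(mean_preimage p xpredT) (_ : [set x | _] = setT) ?MT ?mulr1//.
  by apply/seteqP; split.
(* On an empty fibre the value of [a] is unconstrained, but the mass is zero. *)
apply: ler_sum => t _; have [->|/set0P[x xt]] := eqVneq [set x | p x = t] set0.
  by rewrite mean_set0 !mulr0.
by rewrite ler_wpM2r// -xt -hE.
Qed.

(** The zero function [h - h] has the difference of the two values as a mean, so [has_mean_le]
    applies in both directions. *)
Lemma has_mean_unique h r1 r2 : has_mean h r1 -> has_mean h r2 -> r1 = r2.
Proof.
have le r r' : has_mean h r -> has_mean h r' -> r <= r'.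
  move=> hr hr'; rewrite -subr_le0 -mulN1r.
  apply: has_mean_le (has_meanD hr (has_meanZ (-1) hr')) _ => x.
  by rewrite mulN1r subrr.
by move=> hr1 hr2; apply/eqP; rewrite eq_le !le.
Qed.

Lemma has_mean_int (k : X -> int) (N : nat) : (forall x, `|k x| <= N%:Z) ->
  exists r, has_mean (fun x => (k x)%:~R) r.
Proof.
move=> kN; pose psi x : 'I_(N + N).+1 := inord (absz (k x + N%:Z)).
pose a (t : 'I_(N + N).+1) : R := (Posz t - N%:Z)%:~R.
eexists; exists 'I_(N + N).+1, psi, a; split=> // x.
by rewrite /a /psi inordK; have := kN x; [move=> ?; congr (_%:~R); lia|lia].
Qed.

Context (act_left : left_action act).
Context (s : seq G) (w : G -> R).
Context (w_ge0 : forall g, 0 <= w g) (w_sum : \sum_(g <- s) w g = 1).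
Context (wV : forall g, w g^-1%g = w g) (sV : forall g, (g^-1%g \in s) = (g \in s)).
Context (sumV : forall F : G -> R, \sum_(g <- s) F g = \sum_(g <- s) F g^-1%g).

(* The increments of [u] are bounded but [u] need not be, so the drift has zero
   mean only thanks to the symmetry of [w]; rounding [K u] for a large [K] makes
   the increments finite-valued. *)
Lemma no_negative_drift (u : X -> R) (b delta : R) (ball : seq G) : 0 < delta ->
  (forall g x, g \in s -> `|u (act g x) - u x| <= b) ->
  ~ (forall x, \sum_(h <- ball) \sum_(g <- s)
       w g * (u (act g (act h x)) - u (act h x)) <= - delta).
Proof.
(* Rounding costs at most 1 for each element of [ball], while the drift scales to
   [- K delta = - (size ball + 1)]; a total of at most -1 remains. *)
move=> d0 ub drift; pose K : R := ((size ball)%:R + 1) / delta.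
have K0 : 0 < K by rewrite divr_gt0// ltr_wpDl.
pose U x : int := Num.floor (K * u x).
pose H g x : R := (U (act g x) - U x)%:~R.
have UE x : (U x)%:~R <= K * u x < (U x)%:~R + 1.
  by rewrite -[X in _ + X]/((1 : int)%:~R) -intrD floor_itv// num_real.
(* For [g] in [s], [ub] bounds the integer-valued [H g]; elsewhere [r] gets the dummy value 0, so
   that choice yields a total function. *)
have H_mean g : exists r, g \in s -> has_mean (H g) r.
  have [gs|] := boolP (g \in s); last by exists 0.
  suff [r ?] : exists r, has_mean (H g) r by exists r.
  apply: (@has_mean_int _ (Num.truncn (K * b + 1)).+1) => x.
  rewrite -(ler_int R) intr_norm.
  apply: (@le_trans _ _ (K * b + 1)); last exact/ltW/truncnS_gt.
  have := ub g x gs; rewrite !ler_norml => /andP[].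
  have /andP[] := UE x; have /andP[] := UE (act g x).
  rewrite intrB; nra.
have [r rP] := choice H_mean.
(* [H g^-1] is minus [H g] composed with the action of [g^-1], so invariance makes their means
   opposite. Reindexing by inversion then shows that the weighted sum of [r] is its own opposite. *)
have rV g : g \in s -> r g^-1%g = - r g.
  move=> gs; have gVs : g^-1%g \in s by rewrite sV.
  apply: has_mean_unique (rP _ gVs) _; rewrite -mulN1r.
  have := has_meanZ (-1) (has_mean_act g^-1%g (rP _ gs)).
  congr has_mean; apply/funext => x.
  by rewrite /H -act_left.2 mulgV act_left.1 mulN1r -intrN opprB.
have r0 : \sum_(g <- s) w g * r g = 0.
  have : \sum_(g <- s) w g * r g = - \sum_(g <- s) w g * r g.
    rewrite [LHS]sumV -sumrN !big_seq; apply: eq_bigr => g gs.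
    by rewrite wV rV// mulrN.
  lra.
have mean0 : has_mean (fun x => \sum_(h <- ball) \sum_(g <- s) w g * H g (act h x))
    (\sum_(h <- ball) \sum_(g <- s) w g * r g).
  apply: has_mean_sum => h _; apply: (has_mean_act h (h := fun x => \sum_(g <- s) w g * H g x)).
  by apply: has_mean_sum => g gs; apply: has_meanZ; exact: rP.
suff : (0 : R) <= - 1 by rewrite ler0N1.
have -> : (0 : R) = \sum_(h <- ball) \sum_(g <- s) w g * r g by rewrite r0 big1.
apply: has_mean_le mean0 _ => x.
apply: (@le_trans _ _ (\sum_(h <- ball) (K * (\sum_(g <- s)
    w g * (u (act g (act h x)) - u (act h x))) + 1))).
  apply: ler_sum => h _; rewrite -[X in _ + X]w_sum mulr_sumr -big_split/=.
  apply: ler_sum => g _; rewrite mulrCA -[X in _ + X]mulr1 -mulrDr ler_wpM2l//.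
  have /andP[] := UE (act h x); have /andP[] := UE (act g (act h x)).
  rewrite /H intrB; lra.
rewrite big_split/= -mulr_sumr big_const_seq count_predT iter_addr_0.
have := ler_wpM2l (ltW K0) (drift x); rewrite mulrN {2}/K mulfVK ?gt_eqF//.
lra.
Qed.

End FiniteMean.

(** With [q = sqrt r], [ln r = 2 ln q <= 2 (q - 1) = (q^2 - 1) - (q - 1)^2]. *)
Lemma ln_le_sqrt {R : realType} (r : R) : 0 < r ->
  ln r <= (r - 1) - (Num.sqrt r - 1) ^+ 2.
Proof.
move=> r0; have q0 : 0 < Num.sqrt r by rewrite sqrtr_gt0.
rewrite -{1 2}[r]sqr_sqrtr ?(ltW r0)// expr2 lnM ?posrE//.
have q1 : -1 < Num.sqrt r - 1 by lra.
have := le_ln1Dx q1; rewrite addrC subrK; nra.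
Qed.

(** With [q = sqrt r] and [|q - 1| < d <= 1], [|r - 1| = |q - 1| (q + 1) < 3 d <= e]. *)
Lemma sqrt_near1 {R : realType} (e : R) : 0 < e -> exists2 eta, 0 < eta &
  forall r, 0 < r -> (Num.sqrt r - 1) ^+ 2 < eta -> `|r - 1| < e.
Proof.
move=> e0; pose d := Num.min 1 (e / 3).
have d0 : 0 < d by rewrite lt_min ltr01 divr_gt0.
have [d1 de] : d <= 1 /\ d <= e / 3 by rewrite !ge_min !lexx orbT.
exists (d ^+ 2) => [|r r0 rd]; first exact: exprn_gt0.
move: rd; rewrite -real_normK ?num_real// ltr_pXn2r ?nnegrE ?(ltW d0)//.
rewrite -{2}[r]sqr_sqrtr ?(ltW r0)// !ltr_norml => /andP[q1 q2].
have := sqrtr_ge0 r; nra.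
Qed.

Lemma seq_lower_bound {R : realType} {T : eqType} (l : seq T) (w : T -> R) :
  (forall i, i \in l -> 0 < w i) -> exists2 c, 0 < c & forall i, i \in l -> c <= w i.
Proof.
elim: l => [_|i l IHl wl]; first by exists 1.
have [|c c0 cP] := IHl; first by move=> j jl; rewrite wl// in_cons jl orbT.
exists (Num.min (w i) c) => [|j]; first by rewrite lt_min c0 wl ?mem_head.
by rewrite in_cons => /orP[/eqP ->|/cP jc]; rewrite ge_min ?lexx ?jc ?orbT.
Qed.

(** * Positive superharmonic functions for amenable actions *)

Section Superharmonic.
Context {R : realType} {G : groupType} {X : pointedType} (act : G -> X -> X).
Context (act_left : left_action act) (s : seq G).

(** A list, possibly with repetitions, so that drifts can be summed over the ball of radius [n]. *)
Fixpoint word_products n : seq G := if n is n'.+1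
  then word_products n' ++ [seq (g * h)%g | g <- s, h <- word_products n'] else [:: 1%g].

Lemma mem_word_products n (v : seq G) : all [in s] v -> (size v <= n)%N ->
  (\prod_(g <- v) g)%g \in word_products n.
Proof.
elim: n v => [|n IHn] [|g v] //=; rewrite ?big_nil ?inE ?mem_cat//.
  by move=> _ _; have := IHn [::]; rewrite big_nil => ->.
move=> /andP[gs vs] vn; rewrite big_cons; apply/orP; right.
by apply: allpairs_f => //; exact: IHn.
Qed.

(** The ratio of [f] along a word is the product of its ratios along the letters, so controlling
    single steps throughout the ball is enough. *)
Lemma ratio_near1 (f : X -> R) (f_gt0 : forall x, 0 < f x) n (e : R) : 0 < e ->
  exists2 eta, 0 < eta & forall x,
    (forall h g, h \in word_products n -> g \in s ->
       `|f (act g (act h x)) / f (act h x) - 1| < eta) ->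
    forall v, all [in s] v -> (size v <= n)%N ->
      `|f (act (\prod_(g <- v) g)%g x) / f x - 1| < e.
Proof.
have ratio1 x : `|f (act 1%g x) / f x - 1| = 0.
  by rewrite act_left.1 divff ?subrr ?normr0// gt_eqF.
elim: n e => [|n IHn] e e0.
  by exists 1 => // x _ [|//]; rewrite big_nil ratio1.
pose d := Num.min 1 (e / 2).
have d0 : 0 < d by rewrite lt_min ltr01 divr_gt0.
have [d1 de] : d <= 1 /\ d <= e / 2 by rewrite !ge_min !lexx orbT.
have [eta eta0 etaP] := IHn d d0.
(* For a last step [a] and a previous ratio [b < 2], [|a b - 1| <= |a - 1| b + |b - 1| < 2 (e / 4) +
   e / 2]. *)
exists (Num.min eta (e / 4)) => [|x near1 [|g v]/=].
- by rewrite lt_min eta0 divr_gt0.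
- by rewrite big_nil ratio1.
move=> /andP[gs vs] vn; rewrite big_cons act_left.2.
set y := act _ x.
have near1' h k : h \in word_products n -> k \in s ->
    `|f (act k (act h x)) / f (act h x) - 1| < Num.min eta (e / 4).
  by move=> hn ks; apply: near1 => //; rewrite mem_cat hn.
have b1 : `|f y / f x - 1| < d.
  by apply: etaP => // h k hn ks; have := near1' h k hn ks; rewrite lt_min => /andP[].
have a1 : `|f (act g y) / f y - 1| < e / 4.
  by have := near1' _ g (mem_word_products vs vn) gs; rewrite lt_min => /andP[].
have -> : f (act g y) / f x = f (act g y) / f y * (f y / f x).
  by rewrite mulrA divfK// gt_eqF.
move: a1 b1; rewrite !ltr_norml => /andP[a1 a2] /andP[b1 b2].
by apply/andP; split; nra.
Qed.

Context (w : G -> R) (w_ge0 : forall g, 0 <= w g).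
Context (w_gt0 : forall g, g \in s -> 0 < w g) (w_sum : \sum_(g <- s) w g = 1).
Context (wV : forall g, w g^-1%g = w g) (sV : forall g, (g^-1%g \in s) = (g \in s)).
Context (sumV : forall F : G -> R, \sum_(g <- s) F g = \sum_(g <- s) F g^-1%g).

Lemma amenable_near_constant (f : X -> R) n (e : R) :
  amenable_action R act -> (forall x, 0 < f x) ->
  (forall x, \sum_(g <- s) w g * f (act g x) <= f x) -> 0 < e ->
  exists x, forall v, all [in s] v -> (size v <= n)%N ->
    `|f (act (\prod_(g <- v) g)%g x) / f x - 1| < e.
Proof.
move=> [m [mT m_act]] f_gt0 f_sup e0.
have m_fin A : m A \is a fin_num.
  rewrite ge0_fin_numE ?measure_ge0//; apply: (@le_lt_trans _ _ 1%E); last exact: ltry.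
  by rewrite -mT; apply: le_measure; rewrite ?inE.
pose M A := fine (m A).
have M_ge0 A : 0 <= M A by exact: fine_ge0.
have MT : M setT = 1 by rewrite /M mT.
have MU A B : A `&` B = set0 -> M (A `|` B) = M A + M B.
  by move=> AB; rewrite /M -fineD//; congr fine; exact: measureU.
have M_act g A : M (act g @^-1` A) = M A.
  rewrite /M -(m_act g); congr (fine (m _)); apply/seteqP; split=> [_ [x Ax <-]//|x Ax].
  by exists (act g^-1%g x); rewrite /= ?(actVK act_left).
pose u x := ln (f x); pose q g x := (Num.sqrt (f (act g x) / f x) - 1) ^+ 2.
(* A Harnack bound: one term of [P f] is at most [f x], so [u] rises by at most [- ln (w g)] in one
   step. Applying this to [g^-1] bounds the fall as well. *)
have step_le g x : g \in s -> w g * f (act g x) <= f x.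
  move=> gs; apply: le_trans (f_sup x); rewrite (big_rem g)//= lerDl.
  by apply: sumr_ge0 => h _; rewrite mulr_ge0// ltW.
have u_le g x : g \in s -> u (act g x) - u x <= \sum_(h <- s) `|ln (w h)|.
  move=> gs; apply: (@le_trans _ _ `|ln (w g)|); last first.
    by rewrite (big_rem g)//= lerDl; apply: sumr_ge0 => h _; exact: normr_ge0.
  apply: (@le_trans _ _ (- ln (w g))); last by rewrite ler_normr lexx orbT.
  have : ln (w g * f (act g x)) <= u x.
    by rewrite ler_ln ?posrE ?mulr_gt0 ?w_gt0// step_le.
  by rewrite lnM ?posrE ?w_gt0// -/(u _); lra.
have u_bound g x : g \in s -> `|u (act g x) - u x| <= \sum_(h <- s) `|ln (w h)|.
  move=> gs; rewrite ler_norml u_le// andbT lerNl opprB.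
  by rewrite -{1}(actK act_left g x) u_le// sV.
(* The terms linear in the ratio sum to [P f x / f x - 1 <= 0]; only the squares survive. *)
have drift x : \sum_(g <- s) w g * (u (act g x) - u x) <= - \sum_(g <- s) w g * q g x.
  apply: (@le_trans _ _ (\sum_(g <- s) w g * (f (act g x) / f x - 1 - q g x))).
    apply: ler_sum => g _; rewrite ler_wpM2l// /u -ln_div ?posrE//.
    by apply: ln_le_sqrt; rewrite divr_gt0.
  under eq_bigr do rewrite mulrBr mulrBr mulr1 mulrA.
  rewrite !sumrB w_sum -mulr_suml gerDr subr_le0.
  by rewrite ler_pdivrMr// mul1r.
apply: contrapT => /forallNP far.
have [eta1 eta1_gt0 eta1P] := ratio_near1 f_gt0 n e0.
have [eta2 eta2_gt0 eta2P] := sqrt_near1 eta1_gt0.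
have [c c0 cP] := seq_lower_bound w_gt0.
apply: (no_negative_drift M_ge0 MT MU M_act act_left w_ge0 w_sum wV sV sumV
  (u := u) (ball := word_products n) (mulr_gt0 c0 eta2_gt0) u_bound) => x.
apply: le_trans (ler_sum _ (fun h _ => drift (act h x))) _; rewrite sumrN lerN2.
have q_ge0 g y : 0 <= w g * q g y by rewrite mulr_ge0// sqr_ge0.
(* If every step inside the ball around [x] had [q < eta2], [x] would satisfy the conclusion. One
   bad step already contributes [c * eta2] to the summed drift. *)
have [h [g [hn gs qg]]] : exists h g, [/\ h \in word_products n, g \in s & eta2 <= q g (act h x)].
  apply: contrapT => small; apply: (far x); apply: eta1P => h g hn gs.
  apply: eta2P; first exact: divr_gt0.
  by rewrite ltNge; apply/negP => qg; apply: small; exists h, g.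
rewrite (big_rem h)//= (big_rem g)//=; apply: ler_wpDr; last apply: ler_wpDr.
- by apply: sumr_ge0 => k _; apply: sumr_ge0 => l _; exact: q_ge0.
- by apply: sumr_ge0 => l _; exact: q_ge0.
by apply: ler_pM => //; [exact: ltW|exact: ltW|exact: cP].
Qed.

End Superharmonic.

Theorem corollary2 (R : realType) (G : groupType) (X : pointedType)
    (act : G -> X -> X)
    (act_left : left_action act)
    (act_trans : transitive_action act)
    (X_countable : countable [set: X])
    (mu : probability (discrete_group G) R)
    (mu_fs : finitely_supported mu)
    (mu_gen : generating mu)
    (mu_sym : symmetric_measure mu)
    (beta : nat -> R)
    (beta_gt0 : forall n, 0 < beta n)
    (beta_noninc : forall m n, (m <= n)%N -> beta n <= beta m)
    (beta_lim : beta @ \oo --> 0) :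
  amenable_action R act <->
  (forall f : X -> R,
     (forall x, 0 < f x) ->
     superharmonic act mu f ->
     exists E : nat -> X, forall n g,
       word_ball (msupport mu) n g ->
       `|f (act g (E n)) / f (E n) - 1| < beta n).
Proof.
have [s s_uniq sE] := msupport_seq mu_fs.
pose w (g : G) := fine (mu [set g]).
have w_ge0 g : 0 <= w g by exact: weight_ge0.
have supp g : g \in s -> msupport mu g by move=> gs; rewrite sE.
have w_gt0 g : g \in s -> 0 < w g by move=> /supp; exact: weight_gt0.
have w_sum := sum_weight mu_fs s_uniq sE.
have word := generating_word mu_fs sE mu_gen.
have markovE := markov_operator_seq s_uniq sE act.
split=> [amen f f_gt0 f_sup|near].
  have near n : exists x, forall v, all [in s] v -> (size v <= n)%N ->
      `|f (act (\prod_(g <- v) g)%g x) / f x - 1| < beta n.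
    apply: (amenable_near_constant act_left w_ge0 w_gt0 w_sum) => //.
    - by move=> g; exact: weightV.
    - by move=> g; exact: (mem_supportV sE mu_sym).
    - by move=> F; exact: (reindex_supportV s_uniq sE mu_sym).
    - by move=> x; rewrite -markovE; exact: f_sup.
  have [E EP] := choice near; exists E => n g [v [vn vs ->]]; apply: EP => //.
  by apply/allP => h /vs; rewrite sE.
apply: (almost_invariant_amenable act_left word w_ge0 w_gt0) => kappa0 kappa0_gt0.
apply: contrapT => gap.
(* The truncation meets the bound [kappa <= 1] of [gap_superharmonic], and the gap persists for a
   smaller constant. *)
pose kappa := Num.min kappa0 1.
have kappa_gt0 : 0 < kappa by rewrite lt_min kappa0_gt0 ltr01.
have kappa_le1 : kappa <= 1 by rewrite ge_min lexx orbT.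
have word_trans x y : exists2 v : seq G,
    all [in s] v & act (\prod_(g <- v) g)%g x = y.
  by have [g <-] := act_trans x y; have [v vs ->] := word g; exists v.
have [|f [p [f_gt0 p1] fp]] :=
    gap_superharmonic act_left w_ge0 w_gt0 w_sum word_trans kappa_gt0 kappa_le1.
  move=> phi fphi _; rewrite leNgt; apply/negP => small; apply: gap; exists phi => //.
  apply: lt_le_trans small _; apply: ler_wpM2r; last by rewrite ge_min lexx.
  by apply: fsumr_ge0 => x _; exact: sqr_ge0.
have [|E EP] := near f f_gt0.
  by move=> x; rewrite markovE; apply: le_trans (fp x) _; rewrite ger_pMl// ltW.
(* Positivity of [n] makes each single letter a word of admissible length; hence the witness
   [N.+1]. *)
have [n n0 bn] : exists2 n, (0 < n)%N & beta n < 1 - p.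
  have /cvgrPdist_lt /(_ (1 - p)) := beta_lim; rewrite subr_gt0 => /(_ p1) [N _ NP].
  exists N.+1 => //; have /= := NP N.+1 (leqnSn N).
  by rewrite sub0r normrN gtr0_norm.
(* Since [beta n < 1 - p], each neighbour of [E n] has a value above [p * f (E n)]; averaging
   contradicts [P f <= p f]. *)
have := fp (E n); rewrite leNgt => /negP; apply.
have -> : p * f (E n) = \sum_(g <- s) w g * (p * f (E n)).
  by rewrite -mulr_suml w_sum mul1r.
have lt_step g : g \in s -> p * f (E n) < f (act g (E n)).
  move=> gs; have : word_ball (msupport mu) n g.
    exists [:: g]; split=> //; last by rewrite big_seq1.
    by move=> h; rewrite inE => /eqP ->; exact: supp.
  move=> /EP; rewrite ltr_norml => /andP[lo _]; rewrite -ltr_pdivlMr//; lra.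
rewrite big_seq [ltRHS]big_seq; apply: ltr_sum.
  (* Strictness of the summed inequality requires a letter; the weights sum to 1, so [s] is
     nonempty. *)
  apply/hasP; case: (s) w_sum lt_step => [|g l] + _.
    by rewrite big_nil => /esym/eqP; rewrite oner_eq0.
  by move=> _; exists g => //; exact: mem_head.
by move=> g gs; rewrite ltr_pM2l ?w_gt0// lt_step.
Qed.
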